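(* Let $\Delta=\sum_{k=1}^s\Delta_k e^{\mathrm i\theta_k}\delta_{T_k}$ be the target measure, with support $\mathbf S=\{T_1,\dots,T_s\}$, let $y=\int_{\mathbb T}\Phi\,d\Delta+\varepsilon$ with $\varepsilon\in\mathbb C^{m+1}$, and assume that $\mathbf S$ satisfies $\mathrm{QIC}(C_a,C_b)$. Let $\lambda>0$ be such that $\lambda\ge\|\varepsilon\|_2$, and let $\hat\Delta=\sum_{k=1}^n\hat\Delta_k e^{\mathrm i\hat\theta_k}\delta_{\hat T_k}$ be a finitely supported solution of the BLASSO problem with parameter $\lambda$. Set $c_0=\sqrt{C_b/C_a}$. Then for every $x\in\mathbb T$ such that $$|\hat\Delta(\{x\})|>\frac{2\lambda}{C_b},$$ there exists $T\in\mathbf S$ satisfying $$d(x,T)\le\Big[\frac{2\lambda}{C_a|\hat\Delta(\{x\})|}\Big]^{1/2}\frac1m\le\frac{c_0}{m}.$$ If moreover $\min_{k\ne l}d(T_k,T_l)>\frac{2c_0}{m}$, then this point $T$ is unique. Furthermore: (1) $\displaystyle\sum_{k:\ \hat T_k\in\mathcal N(c_0,\mathbf S)}\hat\Delta_k\,\min_{T\in\mathbf S}d(\hat T_k,T)^2\le\frac{2\lambda}{C_am^2}$; (2) $\displaystyle\sum_{k:\ \hat T_k\in\mathcal F(c_0,\mathbf S)}\hat\Delta_k\le\frac{2\lambda}{C_b}$.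
   Context: Setting. $(\mathbb T,d)$ is a compact metric space homeomorphic to either the interval $([0,1],|\cdot|)$ or the unit circle (identified with $\mathbb R$ mod $1$, with $d$ the distance around the circle). $m\ge1$ is an integer and $\mathbf F=\{\varphi_0,\dots,\varphi_m\}$ is a family of continuous complex-valued functions on $\mathbb T$ that is orthonormal in $L^2(\Pi)$ for some probability measure $\Pi$ on $\mathbb T$. $\Phi=(\varphi_0,\dots,\varphi_m)$, and $\mathrm{Span}(\mathbf F)$ is the complex linear span of $\mathbf F$. $\mathcal M$ is the set of finite complex measures on $\mathbb T$ and $\|\cdot\|_{TV}$ is the total variation norm. The target measure is $\Delta=\sum_{k=1}^s\Delta_k e^{\mathrm i\theta_k}\delta_{T_k}$ with $\Delta_k>0$, $\theta_k\in\mathbb R$ and $T_k\in\mathbb T$ distinct. One observes $y\in\mathbb C^{m+1}$, $y=\int_{\mathbb T}\Phi\,d\Delta+\varepsilon$, where $\varepsilon\in\mathbb C^{m+1}$ is a noise vector. BLASSO with parameter $\lambda>0$: $\hat\Delta\in\arg\min_{\mu\in\mathcal M}\frac12\big\|\int_{\mathbb T}\Phi\,d\mu-y\big\|_2^2+\lambda\|\mu\|_{TV}$. Finitely supported solutions are considered, written $\hat\Delta=\sum_{k=1}^n\hat\Delta_k e^{\mathrm i\hat\theta_k}\delta_{\hat T_k}$ with $\hat\Delta_k>0$, $\hat\theta_k\in\mathbb R$ and distinct $\hat T_k\in\mathbb T$. Quadratic isolation condition. A finite set $\mathbf S=\{T_1,\dots,T_s\}\subset\mathbb T$ satisfies $\mathrm{QIC}(C_a,C_b)$,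 where $C_a>0$ and $0<C_b<1$, if for all $(\theta_k)_{k=1}^s\in\mathbb R^s$ there exists $P\in\mathrm{Span}(\mathbf F)$ such that $P(T_k)=e^{-\mathrm i\theta_k}$ for all $k$ and, for all $x\in\mathbb T$, $1-|P(x)|\ge\min_{T\in\mathbf S}\min\{C_am^2d(x,T)^2,\,C_b\}$. Neighbourhoods: $\mathcal N(c_0,\mathbf S)=\{x\in\mathbb T:\min_{T\in\mathbf S}d(x,T)\le c_0/m\}$, and $\mathcal F(c_0,\mathbf S)$ is its complement in $\mathbb T$. *)

(* Defs.v *)
From HB Require Import structures.
From mathcomp Require Import all_boot all_order all_algebra.
From mathcomp Require Import all_classical all_reals all_analysis.
From mathcomp Require Import complex.
From mathcomp Require Import lra.

Set Implicit Arguments.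
Unset Strict Implicit.
Unset Printing Implicit Defensive.

Import Order.TTheory GRing.Theory Num.Theory.
Import numFieldNormedType.Exports.
Import ComplexField.Normc.

Local Open Scope classical_set_scope.
Local Open Scope complex_scope.
Local Open Scope ring_scope.

(* Measurable types are pointed in the library, so the metric space carrying
   the measures has to be pointed as well (i.e. nonempty). *)
#[short(type="pointedMetricType")]
HB.structure Definition PointedMetric (K : numDomainType) :=
  {M of Pointed M & Metric K M}.

Definition homeomorphic (X Y : topologicalType) : Prop :=
  exists (f : X -> Y) (g : Y -> X),
    [/\ continuous f, continuous g, cancel f g & cancel g f].

(* The circle R mod 1, with representatives in [0, 1[ and the distance around
   the circle. *)
Definition circle (R : realType) := {x : R | 0 <= x < 1}.

Section circle_metric.
Variable R : realType.
Implicit Types x y z : circle R.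

Definition circle_dist x y : R :=
  Num.min `|val x - val y| (1 - `|val x - val y|).

Lemma circle_distxx x : circle_dist x x = 0.
Proof. by rewrite /circle_dist subrr normr0 subr0 min_l. Qed.

Lemma circle_dist_positivity x y : circle_dist x y = 0 -> x = y.
Proof.
rewrite /circle_dist => xy; apply: val_inj; move: xy.
case: x y => [x /= /andP[x0 x1]] [y /= /andP[y0 y1]].
rewrite minEle; case: ifP => _; case: (ger0P (x - y)) => ? /= ?; lra.
Qed.

Lemma circle_dist_sym x y : circle_dist x y = circle_dist y x.
Proof. by rewrite /circle_dist distrC. Qed.

Lemma circle_dist_triangle y x z :
  circle_dist x z <= circle_dist x y + circle_dist y z.
Proof.
rewrite /circle_dist.
case: x y z => [x /= /andP[? ?]] [y /= /andP[? ?]] [z /= /andP[? ?]].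
have mE (a : R) : (Num.min a (1 - a) <= a) && (Num.min a (1 - a) <= 1 - a).
  by rewrite !ge_min !lexx orbT.
have /andP[] := mE `|x - z|.
rewrite [Num.min `|x - y| _]minEle [Num.min `|y - z| _]minEle.
case: (ger0P (x - y)) => ?; case: (ger0P (y - z)) => ?;
  case: (ger0P (x - z)) => ? ? ?; case: ifP => _; case: ifP => _; lra.
Qed.

HB.instance Definition _ := Choice.on (circle R).
HB.instance Definition _ := @isMetric.Build R (circle R) circle_dist
  circle_distxx circle_dist_positivity circle_dist_sym circle_dist_triangle.

End circle_metric.

Notation borel X := (g_sigma_algebraType (@open X)).

Definition expi (R : realType) (t : R) : R[i] := cos t +i* sin t.

Definition norm2 (R : realType) n (v : 'rV[R[i]]_n) : R :=
  Num.sqrt (\sum_(j < n) normc (v ord0 j) ^+ 2).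

Definition ordmin (R : realType) n (f : 'I_n.+1 -> R) : R :=
  \big[Num.min/f ord0]_(k < n.+1) f k.

Section complex_measures.
Context (R : realType) d (X : measurableType d).

(* The values on non-measurable sets are irrelevant; since they are in R[i],
   these measures are finite. *)
Record complex_measure := ComplexMeasure {
  cmeas :> set X -> R[i];
  cmeas_sigma_additive : forall F : (set X)^nat,
    (forall n, measurable (F n)) -> trivIset setT F ->
    (fun n => \sum_(i < n) cmeas (F i) : R[i]^o) @ \oo -->
      (cmeas (\bigcup_n F n) : R[i]^o)
}.

Definition total_variation (mu : complex_measure) : \bar R :=
  ereal_sup [set r : \bar R | exists (n : nat) (A : 'I_n -> set X),
    [/\ forall i, measurable (A i), trivIset setT A, \bigcup_i A i = setT &
        r = (\sum_(i < n) normc (mu (A i)))%:E]].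

Implicit Type mu : complex_measure.

Lemma normcE (z : R[i]) : `|z| = (normc z)%:C.
Proof. by case: z. Qed.

Lemma le_Re_normc (z : R[i]) : `|complex.Re z| <= normc z.
Proof. by case: z => a b /=; rewrite -sqrtr_sqr ler_wsqrtr// lerDl sqr_ge0. Qed.

Lemma le_Im_normc (z : R[i]) : `|complex.Im z| <= normc z.
Proof. by case: z => a b /=; rewrite -sqrtr_sqr ler_wsqrtr// lerDr sqr_ge0. Qed.

Lemma normc_le (z : R[i]) : normc z <= `|complex.Re z| + `|complex.Im z|.
Proof.
case: z => a b /=; rewrite -[leRHS]ger0_norm ?addr_ge0// -sqrtr_sqr.
rewrite ler_wsqrtr// sqrrD !real_normK ?num_real// addrAC lerDl.
by rewrite mulrn_wge0// mulr_ge0.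
Qed.

Lemma cvg_complexP (u : R[i]^nat) (l : R[i]) :
  (u : nat -> R[i]^o) @ \oo --> (l : R[i]^o) <->
  (fun n => complex.Re (u n)) @ \oo --> complex.Re l /\
  (fun n => complex.Im (u n)) @ \oo --> complex.Im l.
Proof.
have ReB (z w : R[i]) : complex.Re (z - w) = complex.Re z - complex.Re w.
  by case: z w => ? ? [].
have ImB (z w : R[i]) : complex.Im (z - w) = complex.Im z - complex.Im w.
  by case: z w => ? ? [].
split=> [/cvgrPdist_lt ul|[/cvgrPdist_lt re_ul /cvgrPdist_lt im_ul]].
  have {}ul (e : R) : 0 < e -> \forall n \near \oo, normc (l - u n) < e.
    move=> e0; have := ul e%:C; rewrite ltcR => /(_ e0); apply: filterS => n.
    by rewrite normcE ltcR.
  split; apply/cvgrPdist_lt => e /ul; apply: filterS => n; apply: le_lt_trans.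
    by rewrite -ReB le_Re_normc.
  by rewrite -ImB le_Im_normc.
apply/cvgrPdist_lt => -[e e']; rewrite ltcE /= => /andP[/eqP -> e0].
have e20 : 0 < e / 2 by rewrite divr_gt0.
near=> n; rewrite normcE ltcR (le_lt_trans (normc_le _))// ReB ImB.
rewrite [ltRHS]splitr ltrD//; near: n; [exact: re_ul|exact: im_ul].
Unshelve. all: by end_near. Qed.

Lemma cmeas0 mu : mu set0 = 0.
Proof.
have := @cmeas_sigma_additive mu (fun=> set0) (fun=> measurable0).
rewrite bigcup0// => cu; have {cu} : (fun n => mu set0 *+ n : R[i]^o) @ \oo -->
    (mu set0 : R[i]^o).
  under eq_fun do rewrite -[n in _ *+ n]card_ord -sumr_const.
  by apply: cu; apply/trivIsetP => i j _ _ _; rewrite setI0.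
move=> cu; have cS := cu; rewrite -cvg_shiftS in cS.
have := cvgB cS cu; rewrite subrr.
rewrite (_ : (_ - _)%R = fun=> mu set0); last first.
  by apply/funext => n /=; rewrite !fctE mulrS addrK.
have hC : hausdorff_space R[i]^o by exact: norm_hausdorff.
move=> h; apply/(cvg_unique hC _ (h _)); exact: cvg_cst.
Qed.

Section parts.
Variable mu : complex_measure.

Definition cmeas_re (A : set X) : \bar R := (complex.Re (mu A))%:E.
Definition cmeas_im (A : set X) : \bar R := (complex.Im (mu A))%:E.

Let re0 : cmeas_re set0 = 0%E. Proof. by rewrite /cmeas_re cmeas0. Qed.
Let im0 : cmeas_im set0 = 0%E. Proof. by rewrite /cmeas_im cmeas0. Qed.

Let re_fin A : measurable A -> cmeas_re A \is a fin_num. Proof. by []. Qed.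
Let im_fin A : measurable A -> cmeas_im A \is a fin_num. Proof. by []. Qed.

Lemma Re_sum n (f : 'I_n -> R[i]) :
  complex.Re (\sum_(i < n) f i) = \sum_(i < n) complex.Re (f i).
Proof. by apply: (big_morph (@complex.Re R)) => [[? ?] [? ?]|]. Qed.

Lemma Im_sum n (f : 'I_n -> R[i]) :
  complex.Im (\sum_(i < n) f i) = \sum_(i < n) complex.Im (f i).
Proof. by apply: (big_morph (@complex.Im R)) => [[? ?] [? ?]|]. Qed.

Let re_sigma_additive : semi_sigma_additive cmeas_re.
Proof.
move=> F mF tF mUF; have /cvg_complexP[+ _] := @cmeas_sigma_additive mu F mF tF.
rewrite /cmeas_re => cu; under eq_fun do rewrite sumEFin /= big_mkord -Re_sum.
by apply: cvg_EFin => //; exact: nearW.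
Qed.

Let im_sigma_additive : semi_sigma_additive cmeas_im.
Proof.
move=> F mF tF mUF; have /cvg_complexP[_ +] := @cmeas_sigma_additive mu F mF tF.
rewrite /cmeas_im => cu; under eq_fun do rewrite sumEFin /= big_mkord -Im_sum.
by apply: cvg_EFin => //; exact: nearW.
Qed.

HB.instance Definition _ := isCharge.Build _ _ _ cmeas_re
  re0 re_fin re_sigma_additive.
HB.instance Definition _ := isCharge.Build _ _ _ cmeas_im
  im0 im_fin im_sigma_additive.

End parts.

Section discrete.
Variables (n : nat) (w : 'I_n -> R[i]) (t : 'I_n -> X).

Let atoms (A : set X) : R[i] := \sum_(k < n) w k * (\1_A (t k))%:C.

Let atoms_sigma_additive (F : (set X)^nat) :
  (forall n, measurable (F n)) -> trivIset setT F ->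
  (fun n => \sum_(i < n) atoms (F i) : R[i]^o) @ \oo -->
    (atoms (\bigcup_n F n) : R[i]^o).
Proof.
move=> mF tF; rewrite /atoms; under eq_fun do rewrite exchange_big /=.
apply: cvg_big => [|k _]; first exact: add_continuous.
under eq_fun do rewrite -mulr_sumr.
apply: cvgM; first exact: cvg_cst.
apply/cvg_complexP; split => /=; last first.
  by under eq_fun do rewrite Im_sum big1//; exact: cvg_cst.
under eq_fun do rewrite Re_sum /=.
have := @measure_semi_sigma_additive _ _ _ (\d_(t k) : {measure set X -> \bar R})
  F mF tF (bigcup_measurable (fun i _ => mF i)).
move=> /fine_cvg; apply: cvg_trans; apply: near_eq_cvg; apply: nearW => N /=.
by rewrite sumEFin /= big_mkord.
Qed.

Definition discrete_measure : complex_measure :=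
  ComplexMeasure atoms_sigma_additive.

End discrete.

Section integral.

(* The integral against a finite signed measure does not depend on the chosen
   Hahn decomposition. *)
Definition charge_integral (nu : {charge set X -> \bar R}) (f : X -> R) : R :=
  let HP := cid (Hahn_decomposition nu) in
  let HN := cid (projT2 HP) in
  let nuPN := projT2 HN in
  (\int[jordan_pos nuPN]_x f x) - (\int[jordan_neg nuPN]_x f x).

Definition cmeas_integral mu (f : X -> R[i]) : R[i] :=
  (charge_integral (cmeas_re mu) (fun x => complex.Re (f x)) -
   charge_integral (cmeas_im mu) (fun x => complex.Im (f x))) +i*
  (charge_integral (cmeas_re mu) (fun x => complex.Im (f x)) +
   charge_integral (cmeas_im mu) (fun x => complex.Re (f x))).

Definition complex_integral (P : {measure set X -> \bar R}) (f : X -> R[i]) :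
    R[i] :=
  (\int[P]_x complex.Re (f x)) +i* (\int[P]_x complex.Im (f x)).

End integral.

End complex_measures.

Section blasso.
Context (R : realType) (X : pointedMetricType R).

Definition polar_measure n (a theta : 'I_n -> R) (t : 'I_n -> X) :
    complex_measure R (borel X) :=
  discrete_measure (fun k => (a k)%:C * expi (theta k)) (t : 'I_n -> borel X).

Section family.
Variables (m : nat) (phi : 'I_m.+1 -> X -> R[i]).

Definition orthonormalF (Pi : {measure set (borel X) -> \bar R}) : Prop :=
  forall i j, complex_integral Pi (fun x => phi i x * (phi j x)^*) = (i == j)%:R.

Definition spanF : set (X -> R[i]) :=
  [set P | exists c : 'I_m.+1 -> R[i],
     forall x, P x = \sum_(j < m.+1) c j * phi j x].

Definition moments (mu : complex_measure R (borel X)) : 'rV[R[i]]_m.+1 :=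
  \row_j cmeas_integral mu (phi j).

Definition blasso_objective (y : 'rV[R[i]]_m.+1) (lambda : R)
    (mu : complex_measure R (borel X)) : \bar R :=
  ((2^-1 * norm2 (moments mu - y) ^+ 2)%:E + lambda%:E * total_variation mu)%E.

Definition blasso_solution y lambda mu : Prop :=
  forall nu, (blasso_objective y lambda mu <= blasso_objective y lambda nu)%E.

Definition QIC s (T : 'I_s.+1 -> X) (Ca Cb : R) : Prop :=
  forall theta : 'I_s.+1 -> R, exists P : X -> R[i],
    [/\ spanF P,
        forall k, P (T k) = expi (- theta k) &
        forall x, 1 - normc (P x) >=
          ordmin (fun k => Num.min (Ca * m%:R ^+ 2 * mdist x (T k) ^+ 2) Cb)].

End family.

Definition near_set (m : nat) (c0 : R) s (T : 'I_s.+1 -> X) : set X :=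
  [set x | ordmin (fun k => mdist x (T k)) <= c0 / m%:R].

Definition far_set (m : nat) (c0 : R) s (T : 'I_s.+1 -> X) : set X :=
  ~` near_set m c0 T.

End blasso.

(* Main.v *)
(* Take the QIC interpolant P = sum_j c_j phi_j of the conjugate phases of the
   target.  Since |P| <= 1 and the phi_j are orthonormal for a probability
   measure, Parseval gives |c|_2 <= 1, so pairing with c is 1-Lipschitz on the
   moment vectors.  With r the residual of the solution, comparing its BLASSO
   objective with that of the target then yields
     sum_k hat a_k (1 - |P(hat T_k)|)
       <= (|eps|^2 - |r|^2) / (2 lambda) + |r| + |eps| <= 2 lambda,
   using |eps| <= lambda and (lambda - |r|)^2 >= 0.  Every claim follows by
   inserting the quadratic lower bound of QIC on 1 - |P| into this sum. *)
Require Import Defs.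
From HB Require Import structures.
From mathcomp Require Import all_boot all_order all_algebra.
From mathcomp Require Import all_classical all_reals all_analysis.
From mathcomp Require Import complex.
From mathcomp Require Import measurable_realfun ring lra.
Import Order.TTheory GRing.Theory Num.Theory.
Import numFieldNormedType.Exports.
Import ComplexField.Normc.
Local Open Scope classical_set_scope.
Local Open Scope complex_scope.
Local Open Scope ring_scope.

(** * Integration against finitely supported measures and charges *)

Lemma ge0_integral_atoms {d} {X : measurableType d} {R : realType}
    (mu : {measure set X -> \bar R}) {n} (u : 'I_n -> R) (t : 'I_n -> X)
    (f : X -> \bar R) (u_ge0 : forall k, 0 <= u k)
    (muE : forall A, measurable A -> mu A = (\sum_(k < n) u k * \1_A (t k))%:E)
    (mf : measurable_fun setT f) (f_ge0 : forall x, (0 <= f x)%E) :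
  (\int[mu]_x f x = \sum_(k < n) (u k)%:E * f (t k))%E.
Proof.
(* [msum] sums a sequence indexed by [nat]; the padding by [mzero] from index [n] on never enters
   the sum. *)
pose atom (i : nat) : {measure set X -> \bar R} :=
  if insub i is Some k then mscale (NngNum (u_ge0 k)) (\d_(t k))
  else mzero.
rewrite (eq_measure_integral (msum atom n)); last first.
  move=> A mA _; rewrite muE//= /msum -sumEFin; apply: eq_bigr => k _.
  by rewrite /atom valK.
rewrite ge0_integral_measure_sum//; apply: eq_bigr => k _.
rewrite /atom valK ge0_integral_mscale// integral_dirac//.
by rewrite diracT mul1e.
Qed.

Lemma Rintegral_atoms {d} {X : measurableType d} {R : realType}
    (mu : {measure set X -> \bar R}) {n} (u : 'I_n -> R) (t : 'I_n -> X)
    (f : X -> R) (u_ge0 : forall k, 0 <= u k)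
    (muE : forall A, measurable A -> mu A = (\sum_(k < n) u k * \1_A (t k))%:E)
    (mf : measurable_fun setT f) :
  \int[mu]_x f x = \sum_(k < n) u k * f (t k).
Proof.
have mEf : measurable_fun setT (EFin \o f) by exact/measurable_EFinP.
rewrite /Rintegral integralE.
rewrite !(ge0_integral_atoms _ _ _ _ u_ge0 muE) //; last 2 first.
- exact: measurable_funeneg.
- exact: measurable_funepos.
rewrite funerpos funerneg.
under eq_bigr do rewrite -EFinM.
under [X in (_ - X)%E]eq_bigr do rewrite -EFinM.
rewrite !sumEFin -EFinB /= -sumrB; apply: eq_bigr => k _.
by rewrite -mulrBr -[in RHS](funrposBneg f).
Qed.

Lemma jordan_posI {d} {X : measurableType d} {R : realType}
    (nu : {charge set X -> \bar R}) {P N : set X}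
    (nuPN : hahn_decomposition nu P N) (A : set X) :
  measurable A -> jordan_pos nuPN A = nu (A `&` P).
Proof. by move=> mA; rewrite jordan_posE cjordan_posE /crestr0 mem_set. Qed.

Lemma jordan_negI {d} {X : measurableType d} {R : realType}
    (nu : {charge set X -> \bar R}) {P N : set X}
    (nuPN : hahn_decomposition nu P N) (A : set X) :
  measurable A -> jordan_neg nuPN A = (- nu (A `&` N))%E.
Proof. by move=> mA; rewrite jordan_negE cjordan_negE /crestr0 mem_set. Qed.

(** Whatever Hahn decomposition [cid] returns, both Jordan parts are again carried by the points
    [t k], with nonnegative weights [w k * \1_P (t k)] and [- (w k * \1_N (t k))], so the formula
    for positive measures applies to each. *)
Lemma charge_integral_atoms {d} {X : measurableType d} {R : realType}
    (nu : {charge set X -> \bar R}) {n} (w : 'I_n -> R) (t : 'I_n -> X)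
    (f : X -> R) (t_inj : injective t) (mt : forall k, measurable [set t k])
    (nuE : forall A, measurable A -> nu A = (\sum_(k < n) w k * \1_A (t k))%:E)
    (mf : measurable_fun setT f) :
  charge_integral nu f = \sum_(k < n) w k * f (t k).
Proof.
rewrite /charge_integral.
case: cid => P HP; case: cid => N nuPN /=.
have [[mP posP] [mN negN] PN PN0] := nuPN.
(* Injectivity of [t] isolates the [k]-th atom, so the sign of [nu] on subsets of [P] and of [N]
   becomes a sign of single weights. *)
have nu1 A k : measurable A -> nu ([set t k] `&` A) = (w k * \1_A (t k))%:E.
  move=> mA; rewrite nuE; last exact: measurableI.
  congr EFin; rewrite (bigD1 k)//= big1 => [|l lk].
    by rewrite addr0 !indicE in_setI mem_set.
  rewrite indicE in_setI memNset ?mulr0// => /t_inj lk'.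
  by rewrite lk' eqxx in lk.
have P_ge0 k : 0 <= w k * \1_P (t k).
  by rewrite -lee_fin -nu1//; apply: posP; [exact: measurableI|move=> ? []].
have N_ge0 k : 0 <= - (w k * \1_N (t k)).
  rewrite oppr_ge0 -lee_fin -nu1//.
  by apply: negN; [exact: measurableI|move=> ? []].
have IE A B k : \1_(A `&` B) (t k) = \1_A (t k) * \1_B (t k) :> R.
  by rewrite indicI.
rewrite (Rintegral_atoms _ _ t f P_ge0) //; last first.
  move=> A mA; transitivity (nu (A `&` P)); first exact: jordan_posI.
  rewrite nuE; last exact: measurableI.
  by congr EFin; apply: eq_bigr => k _; rewrite IE mulrA mulrAC.
rewrite (Rintegral_atoms _ _ t f N_ge0) //; last first.
  move=> A mA; transitivity (- nu (A `&` N))%E; first exact: jordan_negI.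
  rewrite nuE; last exact: measurableI.
  rewrite -EFinN -sumrN.
  by congr EFin; apply: eq_bigr => k _; rewrite IE mulrA mulrAC mulNr.
rewrite -sumrB; apply: eq_bigr => k _.
(* [P] and [N] partition the space: each atom is counted in exactly one Jordan part. *)
have : \1_P (t k) + \1_N (t k) = 1 :> R.
  have := congr1 (fun A => \1_A (t k) : R) PN.
  have := congr1 (fun A => \1_A (t k) : R) PN0.
  rewrite !indicE in_setI in_setU in_set0 in_setT.
  case: (_ \in P); case: (_ \in N) => /=; rewrite ?addr0 ?add0r// => /eqP.
  by rewrite oner_eq0.
by move=> PN1; rewrite mulNr opprK -mulrDl -mulrDr PN1 mulr1.
Qed.

Lemma ReD {R : rcfType} (z w : R[i]) :
  complex.Re (z + w) = complex.Re z + complex.Re w.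
Proof. by case: z w => ? ? []. Qed.

Lemma ImD {R : rcfType} (z w : R[i]) :
  complex.Im (z + w) = complex.Im z + complex.Im w.
Proof. by case: z w => ? ? []. Qed.

Lemma Re_mul {R : rcfType} (z w : R[i]) :
  complex.Re (z * w) = complex.Re z * complex.Re w - complex.Im z * complex.Im w.
Proof. by case: z w => ? ? []. Qed.

Lemma Im_mul {R : rcfType} (z w : R[i]) :
  complex.Im (z * w) = complex.Re z * complex.Im w + complex.Im z * complex.Re w.
Proof. by case: z w => ? ? []. Qed.

Lemma cmeas_integral_discrete {d} {X : measurableType d} {R : realType}
    {n} (w : 'I_n -> R[i]) (t : 'I_n -> X) (f : X -> R[i])
    (t_inj : injective t) (mt : forall k, measurable [set t k])
    (mRe : measurable_fun setT (fun x => complex.Re (f x)))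
    (mIm : measurable_fun setT (fun x => complex.Im (f x))) :
  cmeas_integral (discrete_measure w t) f = \sum_(k < n) w k * f (t k).
Proof.
have reE A : measurable A -> cmeas_re (discrete_measure w t) A =
    (\sum_(k < n) complex.Re (w k) * \1_A (t k))%:E.
  move=> _; rewrite /cmeas_re /= Re_sum; congr EFin; apply: eq_bigr => k _.
  by rewrite Re_mul /= mulr0 subr0.
have imE A : measurable A -> cmeas_im (discrete_measure w t) A =
    (\sum_(k < n) complex.Im (w k) * \1_A (t k))%:E.
  move=> _; rewrite /cmeas_im /= Im_sum; congr EFin; apply: eq_bigr => k _.
  by rewrite Im_mul /= mulr0 add0r.
rewrite /cmeas_integral.
rewrite !(charge_integral_atoms _ _ _ _ t_inj mt reE)//.
rewrite !(charge_integral_atoms _ _ _ _ t_inj mt imE)//.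
rewrite -sumrB -big_split /=.
apply/eqP; rewrite eq_complex /= Re_sum Im_sum; apply/andP; split; apply/eqP;
  apply: eq_bigr => k _; rewrite ?Re_mul ?Im_mul//.
Qed.

(** * Total variation of discrete measures *)

Lemma normc_ge0 {R : rcfType} (z : R[i]) : 0 <= normc z.
Proof. by case: z => a b; exact: sqrtr_ge0. Qed.

(** Disjoint cells contain a given [t k] at most once, so after exchanging the sums no [normc (w k)]
    is counted twice. *)
Lemma total_variation_discrete_le {d} {X : measurableType d} {R : realType}
    {n} (w : 'I_n -> R[i]) (t : 'I_n -> X) :
  (Defs.total_variation (discrete_measure w t) <= (\sum_(k < n) normc (w k))%:E)%E.
Proof.
apply: ge_ereal_sup => _ [N [A [mA tA _ ->]]]; rewrite lee_fin /=.
have normc_sum (m : nat) (F : 'I_m -> R[i]) :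
    normc (\sum_(i < m) F i) <= \sum_(i < m) normc (F i).
  elim/big_ind2: _ => [|x x' y y' xx' yy'|//]; first by rewrite normc0.
  by rewrite (le_trans (le_normcD _ _))// lerD.
apply: (@le_trans _ _ (\sum_(i < N) \sum_(k < n) normc (w k) * \1_(A i) (t k))).
  apply: ler_sum => i _; rewrite (le_trans (normc_sum _ _))// ler_sum// => k _.
  by rewrite normcM /= expr0n addr0 sqrtr_sqr ger0_norm// indicE ler0n.
rewrite exchange_big /=; apply: ler_sum => k _; rewrite -mulr_sumr.
rewrite -[leRHS]mulr1 ler_wpM2l ?normc_ge0//.
have [/existsP[i ki]|/existsPn Ak] := boolP [exists i, t k \in A i]; last first.
  by rewrite big1// => i _; rewrite indicE (negbTE (Ak i)).
rewrite (bigD1 i)//= big1 ?addr0 ?indicE ?ki// => j ji.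
rewrite indicE; case: (boolP (t k \in A j)) => // kj.
by case/eqP: ji; apply: (tA j i) => //; exists (t k); split; exact: set_mem.
Qed.

(** The singletons [[set t k]] and the complement of their union form one admissible partition,
    whose value already reaches the sum. *)
Lemma total_variation_discrete_ge {d} {X : measurableType d} {R : realType}
    {n} (w : 'I_n -> R[i]) (t : 'I_n -> X)
    (t_inj : injective t) (mt : forall k, measurable [set t k]) :
  ((\sum_(k < n) normc (w k))%:E <= Defs.total_variation (discrete_measure w t))%E.
Proof.
(* The extra index [n] holds the leftover set, which makes the family cover the space. *)
pose A (i : 'I_n.+1) : set X :=
  if insub (i : nat) is Some k then [set t k] else ~` range t.
have AE k : A (widen_ord (leqnSn n) k) = [set t k] by rewrite /A valK.
have Amax : A ord_max = ~` range t by rewrite /A insubF//= ltnn.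
apply: le_trans; last first.
  apply: ereal_sup_ubound; exists n.+1, A; split; last by reflexivity.
  - move=> i; rewrite /A; case: insubP => [k _ _|_]; first exact: mt.
    apply: measurableC; rewrite [range t](_ : _ = \big[setU/set0]_(k < n) [set t k]).
      by apply: bigsetU_measurable.
    rewrite -bigcup_seq; apply/seteqP; split => [_ [k _ <-]|x [k _ ->]]; exists k => //=.
    by rewrite mem_index_enum.
  - move=> i j _ _ [x []]; rewrite /A.
    case: insubP => [k _ ki|i_ge]; case: insubP => [l _ lj|j_ge] /=.
    + by move=> -> /t_inj kl; apply/val_inj; rewrite /= -ki kl lj.
    + by move=> ->; case; exists k.
    + by move=> xt xl; case: xt; exists l.
    (* Neither index is below [n], so both equal [n]. *)
    + move: i_ge j_ge; rewrite -!leqNgt => ni nj _ _; apply/val_inj/eqP => /=.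
      have := ltn_ord i; have := ltn_ord j; rewrite !ltnS => jn iN.
      by rewrite (@anti_leq i n) ?iN// (@anti_leq j n) ?jn//.
  - apply/seteqP; split => // x _.
    have [[k _ <-]|xt] := pselect (range t x).
      by exists (widen_ord (leqnSn n) k) => //; rewrite AE.
    by exists ord_max => //; rewrite Amax.
rewrite lee_fin big_ord_recr /= -[leLHS]addr0 lerD ?normc_ge0//.
apply: ler_sum => k _; rewrite AE (bigD1 k)//= big1 => [|l lk].
  by rewrite addr0 indicE mem_set// mulr1.
by rewrite indicE memNset ?mulr0// => /t_inj/eqP; exact/negP.
Qed.

(** * Continuity, Borel measurability and integrability *)

Lemma continuous_Re {R : realType} : continuous (@complex.Re R : R[i]^o -> R).
Proof.
move=> z; apply/(@cvgrPdist_lt _ _ _ (nbhs (z : R[i]^o))) => e e0.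
have : \forall w \near (z : R[i]^o), `|z - w| < e%:C.
  by apply: (nbhsx_ballx (z : R[i]^o)); rewrite ltcR.
apply: filterS => w zw; have : (normc (z - w))%:C < e%:C by rewrite -Defs.normcE.
rewrite ltcR; apply: le_lt_trans.
have -> : complex.Re z - complex.Re w = complex.Re (z - w).
  by case: z w {zw} => ? ? [].
exact: le_Re_normc.
Qed.

Lemma continuous_Im {R : realType} : continuous (@complex.Im R : R[i]^o -> R).
Proof.
move=> z; apply/(@cvgrPdist_lt _ _ _ (nbhs (z : R[i]^o))) => e e0.
have : \forall w \near (z : R[i]^o), `|z - w| < e%:C.
  by apply: (nbhsx_ballx (z : R[i]^o)); rewrite ltcR.
apply: filterS => w zw; have : (normc (z - w))%:C < e%:C by rewrite -Defs.normcE.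
rewrite ltcR; apply: le_lt_trans.
have -> : complex.Im z - complex.Im w = complex.Im (z - w).
  by case: z w {zw} => ? ? [].
exact: le_Im_normc.
Qed.

Lemma measurable_fun_continuous_borel {R : realType} {X : pointedMetricType R}
  (f : X -> R) : continuous f -> measurable_fun setT (f : borel X -> R).
Proof.
move=> /continuousP cf.
apply: (measurability _ (RGenOpens.measurableE R)) => _ [_ [a [b ->] <-]].
by rewrite setTI; apply: sub_sigma_algebra; exact/cf/interval_open.
Qed.

Lemma measurable_set1_borel {R : realType} {X : pointedMetricType R} (x : X) :
  measurable ([set x] : set (borel X)).
Proof.
rewrite -[X in measurable X]setCK; apply: measurableC.
apply: sub_sigma_algebra; apply: closed_openC.
by apply/accessible_closed_set1/hausdorff_accessible; exact: metric_hausdorff.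
Qed.

(** Compactness makes [f] bounded, and a bounded measurable function is integrable for a finite
    measure. *)
Lemma integrable_continuous_borel {R : realType} {X : pointedMetricType R}
    (mu : {finite_measure set (borel X) -> \bar R}) (f : X -> R) :
  compact [set: X] -> continuous f -> mu.-integrable setT (EFin \o f).
Proof.
move=> cX cf; apply: measurable_bounded_integrable => //.
- by rewrite ltey_eq fin_num_measure.
- exact: measurable_fun_continuous_borel.
have := @compact_bounded R R (f @` setT).
case; first by apply: continuous_compact => //; exact: continuous_subspaceT.
move=> M [Mr bM]; exists M; split => // N MN x _.
by apply: (bM N MN); exists x.
Qed.

(** * Linearity of the complex integral *)

Section complex_integral.
Context {d} {X : measurableType d} {R : realType} (mu : {measure set X -> \bar R}).

Definition cintegrable (f : X -> R[i]) : Prop :=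
  mu.-integrable setT (EFin \o (fun x => complex.Re (f x))) /\
  mu.-integrable setT (EFin \o (fun x => complex.Im (f x))).

Lemma complex_integralD (f g : X -> R[i]) : cintegrable f -> cintegrable g ->
  cintegrable (fun x => f x + g x) /\
  complex_integral mu (fun x => f x + g x) =
    complex_integral mu f + complex_integral mu g.
Proof.
have iD := @integrableD _ X R mu setT measurableT.
move=> [fR fI] [gR gI]; rewrite /cintegrable /complex_integral /=.
rewrite (funext (fun x => ReD (f x) (g x))) (funext (fun x => ImD (f x) (g x))).
split; last by rewrite !RintegralD.
by split; [exact: iD fR gR|exact: iD fI gI].
Qed.

Lemma complex_integralZ (c : R[i]) (f : X -> R[i]) : cintegrable f ->
  cintegrable (fun x => c * f x) /\
  complex_integral mu (fun x => c * f x) = c * complex_integral mu f.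
Proof.
move=> [fR fI]; rewrite /cintegrable /complex_integral /=.
rewrite (funext (fun x => Re_mul c (f x))) (funext (fun x => Im_mul c (f x))).
have iZ (r : R) (h : X -> R) : mu.-integrable setT (EFin \o h) ->
    mu.-integrable setT (EFin \o (fun x => r * h x)).
  by move=> ih; exact: (@integrableZl _ _ _ mu setT measurableT r _ ih).
split; [split|].
- exact: (@integrableB _ _ _ mu setT measurableT _ _ (iZ _ _ fR) (iZ _ _ fI)).
- exact: (@integrableD _ _ _ mu setT measurableT _ _ (iZ _ _ fI) (iZ _ _ fR)).
rewrite RintegralB ?RintegralD ?RintegralZl//; try exact: iZ.
by case: c => a b.
Qed.

(** Integrability and value are proved together because the inductive step needs the partial sum to
    be integrable before additivity applies. *)
Lemma complex_integral_sum {n} (f : 'I_n -> X -> R[i]) :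
  (forall i, cintegrable (f i)) ->
  cintegrable (fun x => \sum_(i < n) f i x) /\
  complex_integral mu (fun x => \sum_(i < n) f i x) =
    \sum_(i < n) complex_integral mu (f i).
Proof.
move=> fi; elim: (index_enum _) => [|i s [IH1 IH2]].
  rewrite big_nil; under eq_fun do rewrite big_nil.
  rewrite /cintegrable /complex_integral /= !Rintegral_cst// mul0r.
  by split => //; split; exact: integrable0.
rewrite big_cons -IH2; under eq_fun do rewrite big_cons.
exact: complex_integralD.
Qed.

End complex_integral.

(** * Parseval bound on the coefficients of a function of modulus at most 1 *)

Lemma sqr_normcE {R : rcfType} (z : R[i]) : (normc z ^+ 2)%:C = z * z^*.
Proof.
case: z => a b; apply/eqP; rewrite eq_complex /= sqr_sqrtr ?addr_ge0 ?sqr_ge0//.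
by apply/andP; split; apply/eqP; ring.
Qed.

(** Orthonormality identifies the sum with the integral of the squared modulus against [Pi], which
    is at most the total mass 1. *)
Lemma bessel_le1 {R : realType} {X : pointedMetricType R} {m : nat}
    (phi : 'I_m.+1 -> X -> R[i]) (Pi : probability (borel X) R)
    (c : 'I_m.+1 -> R[i]) :
  compact [set: X] -> (forall j, continuous (phi j : X -> R[i]^o)) ->
  orthonormalF phi Pi ->
  (forall x, normc (\sum_(j < m.+1) c j * phi j x) <= 1) ->
  \sum_(j < m.+1) normc (c j) ^+ 2 <= 1.
Proof.
move=> cX phi_cont phi_ortho P_le1.
have cRe j : continuous (fun x => complex.Re (phi j x)).
  by move=> x; exact: (@continuous_comp X R[i]^o R (phi j) (@complex.Re R) x
    (phi_cont j x) (continuous_Re _)).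
have cIm j : continuous (fun x => complex.Im (phi j x)).
  by move=> x; exact: (@continuous_comp X R[i]^o R (phi j) (@complex.Im R) x
    (phi_cont j x) (continuous_Im _)).
have phi_int i j : cintegrable Pi (fun x => phi i x * (phi j x)^*).
  split; apply: integrable_continuous_borel => //.
    rewrite (_ : (fun _ => _) = fun x => complex.Re (phi i x) * complex.Re (phi j x)
        + complex.Im (phi i x) * complex.Im (phi j x)).
      by move=> x; exact: (cvgD (cvgM (cRe i x) (cRe j x)) (cvgM (cIm i x) (cIm j x))).
    by apply/funext => x; rewrite Re_mul; case: (phi j x) => ? ? /=; ring.
  rewrite (_ : (fun _ => _) = fun x => complex.Im (phi i x) * complex.Re (phi j x)
      - complex.Re (phi i x) * complex.Im (phi j x)).
    by move=> x; exact: (cvgB (cvgM (cIm i x) (cRe j x)) (cvgM (cRe i x) (cIm j x))).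
  by apply/funext => x; rewrite Im_mul; case: (phi j x) => ? ? /=; ring.
set P := fun x => \sum_(j < m.+1) c j * phi j x.
(* The double sum is nested with scalars in front at each level, so that the scaling and sum rules
   apply alternately from the inside out. *)
have PE : (fun x => (normc (P x) ^+ 2)%:C) =
    (fun x => \sum_(i < m.+1) c i * \sum_(j < m.+1) (c j)^* * (phi i x * (phi j x)^*)).
  apply/funext => x; rewrite sqr_normcE /P rmorph_sum mulr_suml; apply: eq_bigr => i _.
  rewrite mulr_sumr mulr_sumr; apply: eq_bigr => j _.
  by rewrite rmorphM /=; ring.
have I1 i j : cintegrable Pi (fun x => (c j)^* * (phi i x * (phi j x)^*)).
  by have [] := complex_integralZ Pi (c j)^* _ (phi_int i j).
have I2 i := complex_integral_sum Pi _ (I1 i).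
have I3 i := complex_integralZ Pi (c i) _ (I2 i).1.
have [I4 I5] := complex_integral_sum Pi _ (fun i => (I3 i).1).
have intE : complex_integral Pi (fun x => (normc (P x) ^+ 2)%:C) =
    (\sum_(j < m.+1) normc (c j) ^+ 2)%:C.
  rewrite PE I5 rmorph_sum; apply: eq_bigr => i _.
  rewrite (I3 i).2 (I2 i).2 [RHS](sqr_normcE (c i)); congr (_ * _).
  rewrite (bigD1 i)//= big1 => [|j ji].
    rewrite (complex_integralZ Pi (c i)^* _ (phi_int i i)).2 phi_ortho.
    by rewrite eqxx mulr1 addr0.
  rewrite (complex_integralZ Pi (c j)^* _ (phi_int i j)).2 phi_ortho.
  by rewrite eq_sym (negbTE ji) mulr0.
move: I4; rewrite -PE => -[I4 _].
(* The integrand is real, so taking real parts turns [intE] into an identity of real integrals,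
   where monotonicity is available. *)
have /(congr1 (@complex.Re R)) /= <- := intE.
apply: (@le_trans _ _ (\int[Pi]_x 1)); last first.
  have PT : Pi [set: borel X] = 1%E by exact: probability_setT.
  rewrite Rintegral_cst// (_ : fine _ = 1) ?mulr1//.
  exact: (congr1 fine PT).
apply: le_Rintegral => //.
  by apply: finite_measure_integrable_cst.
by move=> x _; apply: exprn_ile1; [exact: normc_ge0|exact: P_le1].
Qed.

(** * Finite minima, polar weights and the Euclidean norm *)

Lemma ordmin_le {R : realType} {n : nat} (f : 'I_n.+1 -> R) k : ordmin f <= f k.
Proof. exact: bigmin_le. Qed.

(** The default value of the big minimum is [f ord0], itself a value of [f], so being a value is
    preserved from the start of the iteration. *)
Lemma ordmin_attained {R : realType} {n : nat} (f : 'I_n.+1 -> R) :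
  exists k, ordmin f = f k.
Proof.
rewrite /ordmin; elim/big_ind: _ => [|x y [k ->] [l ->]|k _]; last by exists k.
  by exists ord0.
by rewrite minEle; case: ifP => _; [exists k|exists l].
Qed.

Lemma normc_expi {R : realType} (t : R) : normc (expi t) = 1.
Proof. by rewrite /expi /= cos2Dsin2 sqrtr1. Qed.

Lemma normc_polar {R : realType} (r t : R) : 0 <= r -> normc (r%:C * expi t) = r.
Proof.
by move=> r0; rewrite normcM normc_expi mulr1 /= expr0n addr0 sqrtr_sqr ger0_norm.
Qed.

Lemma norm2N {R : realType} {n : nat} (v : 'rV[R[i]]_n) : norm2 (- v) = norm2 v.
Proof.
by rewrite /norm2; congr Num.sqrt; apply: eq_bigr => j _; rewrite mxE normcN.
Qed.

Lemma norm2_ge0 {R : realType} {n : nat} (v : 'rV[R[i]]_n) : 0 <= norm2 v.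
Proof. exact: sqrtr_ge0. Qed.

(** Cauchy-Schwarz for [c] in the unit ball: a weighted AM-GM bound on each product splits the total
    into two halves, each at most [norm2 v / 2]. *)
Lemma le_Re_dot_norm2 {R : realType} {n : nat} (c : 'I_n -> R[i])
    (v : 'rV[R[i]]_n) : \sum_(j < n) normc (c j) ^+ 2 <= 1 ->
  `|complex.Re (\sum_(j < n) c j * v ord0 j)| <= norm2 v.
Proof.
move=> c_le1.
have N2 : \sum_(j < n) normc (v ord0 j) ^+ 2 = norm2 v ^+ 2.
  by rewrite sqr_sqrtr// sumr_ge0// => j _; exact: sqr_ge0.
apply: (@le_trans _ _ (\sum_(j < n) normc (c j) * normc (v ord0 j))).
  rewrite Re_sum (le_trans (ler_norm_sum _ _ _))// ler_sum// => j _.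
  by rewrite -normcM le_Re_normc.
(* The weight below divides by [norm2 v]; when it vanishes, all entries of [v] are zero. *)
have [N0|N_neq0] := eqVneq (norm2 v) 0.
  rewrite big1 ?N0// => j _; suff -> : normc (v ord0 j) = 0 by rewrite mulr0.
  apply/eqP; rewrite -sqrf_eq0 eq_le sqr_ge0 andbT.
  move: N2; rewrite N0 expr2 mul0r => <-; rewrite (bigD1 j)//= lerDl.
  by rewrite sumr_ge0// => l _; exact: sqr_ge0.
have N_gt0 : 0 < norm2 v by rewrite lt_neqAle eq_sym N_neq0 norm2_ge0.
(* AM-GM with weight [norm2 v] *)
apply: (@le_trans _ _ (\sum_(j < n)
    (norm2 v / 2 * normc (c j) ^+ 2 + (2 * norm2 v)^-1 * normc (v ord0 j) ^+ 2))).
  apply: ler_sum => j _; set x := normc _; set y := normc _.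
  rewrite -subr_ge0.
  have -> : norm2 v / 2 * x ^+ 2 + (2 * norm2 v)^-1 * y ^+ 2 - x * y =
    (norm2 v * x - y) ^+ 2 / (2 * norm2 v) by field.
  by rewrite divr_ge0 ?sqr_ge0// mulr_ge0// ltW.
rewrite big_split /= -!mulr_sumr N2.
have -> : (2 * norm2 v)^-1 * norm2 v ^+ 2 = norm2 v / 2 by field.
rewrite [leRHS]splitr lerD2r -[leRHS]mulr1 ler_wpM2l// divr_ge0//.
exact: norm2_ge0.
Qed.

(** * The dual certificate and the BLASSO optimality inequality *)

Section blasso_certificate.
Context {R : realType} {X : pointedMetricType R} {m : nat}.
Context (phi : 'I_m.+1 -> X -> R[i]).
Context (phi_cont : forall j, continuous (phi j : X -> R[i]^o)).

Lemma moments_polar {n} (a theta : 'I_n -> R) (t : 'I_n -> X) (j : 'I_m.+1) :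
  injective t ->
  moments phi (polar_measure a theta t) ord0 j =
    \sum_(k < n) (a k)%:C * expi (theta k) * phi j (t k).
Proof.
move=> t_inj; rewrite mxE cmeas_integral_discrete//.
- by move=> k; exact: measurable_set1_borel.
- apply: measurable_fun_continuous_borel => x.
  exact: (@continuous_comp X R[i]^o R (phi j) (@complex.Re R) x
    (phi_cont j x) (continuous_Re _)).
- apply: measurable_fun_continuous_borel => x.
  exact: (@continuous_comp X R[i]^o R (phi j) (@complex.Im R) x
    (phi_cont j x) (continuous_Im _)).
Qed.

(** By linearity, pairing moments with [c] amounts to integrating the combination of the [phi j]
    with coefficients [c j] against the measure. *)
Lemma dot_moments_polar {n} (a theta : 'I_n -> R) (t : 'I_n -> X)
    (c : 'I_m.+1 -> R[i]) : injective t ->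
  \sum_(j < m.+1) c j * moments phi (polar_measure a theta t) ord0 j =
    \sum_(k < n) (a k)%:C * expi (theta k) * \sum_(j < m.+1) c j * phi j (t k).
Proof.
move=> t_inj; under eq_bigr do rewrite moments_polar// mulr_sumr.
rewrite exchange_big /=; apply: eq_bigr => k _.
by rewrite mulr_sumr; apply: eq_bigr => j _; ring.
Qed.

Lemma total_variation_polar {n} (a theta : 'I_n -> R) (t : 'I_n -> X) :
  (forall k, 0 < a k) -> injective t ->
  Defs.total_variation (polar_measure a theta t) = (\sum_(k < n) a k)%:E.
Proof.
move=> a_gt0 t_inj.
have aE : \sum_(k < n) a k = \sum_(k < n) normc ((a k)%:C * expi (theta k)).
  by apply: eq_bigr => k _; rewrite normc_polar// ltW.
apply/eqP; rewrite eq_le aE total_variation_discrete_le /=.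
by apply: total_variation_discrete_ge => // k; exact: measurable_set1_borel.
Qed.

Lemma blasso_certificate_bound {s n} (a theta : 'I_s -> R) (T : 'I_s -> X)
    (ha htheta : 'I_n -> R) (hT : 'I_n -> X) (eps : 'rV[R[i]]_m.+1) (lambda : R)
    (c : 'I_m.+1 -> R[i]) :
  let P x := \sum_(j < m.+1) c j * phi j x in
  (forall k, 0 < a k) -> injective T ->
  (forall k, 0 < ha k) -> injective hT ->
  0 < lambda -> norm2 eps <= lambda ->
  blasso_solution phi (moments phi (polar_measure a theta T) + eps) lambda
    (polar_measure ha htheta hT) ->
  \sum_(j < m.+1) normc (c j) ^+ 2 <= 1 ->
  (forall k, P (T k) = expi (- theta k)) ->
  \sum_(k < n) ha k * (1 - normc (P (hT k))) <= 2 * lambda.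
Proof.
move=> P a_gt0 T_inj ha_gt0 hT_inj lambda_gt0 eps_le sol c_le1 PT.
set D := polar_measure a theta T in sol; set hD := polar_measure ha htheta hT in sol.
(* [E] is additive, and on a moment vector it gives the real part of the integral of [P]. *)
pose E (v : 'rV[R[i]]_m.+1) := complex.Re (\sum_(j < m.+1) c j * v ord0 j).
have ED u v : E (u + v) = E u + E v.
  rewrite /E -ReD -big_split /=; congr complex.Re.
  by apply: eq_bigr => j _; rewrite mxE mulrDr.
set r := moments phi hD - (moments phi D + eps).
have EhD : E (moments phi hD) = E (moments phi D) + E r + E eps.
  by rewrite -!ED /r; congr E; rewrite addrAC addrC subrK.
(* At the target the values of [P] cancel the phases exactly, so [E] returns the total variation. *)
have ED_eq : E (moments phi D) = \sum_(k < s) a k.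
  rewrite /E dot_moments_polar// Re_sum; apply: eq_bigr => k _.
  rewrite -/(P (T k)) PT /expi cosN sinN -mulrA Re_mul /= mul0r subr0.
  by rewrite mulrN opprK -!expr2 cos2Dsin2 mulr1.
have EhD_le : E (moments phi hD) <= \sum_(k < n) ha k * normc (P (hT k)).
  rewrite /E dot_moments_polar// Re_sum; apply: ler_sum => k _.
  rewrite -/(P (hT k)) (le_trans (ler_norm _))// (le_trans (le_Re_normc _))//.
  by rewrite normcM normc_polar// ltW.
(* The target has residual [- eps], so [obj] compares [norm2 r ^+ 2 / 2] plus the penalty of the
   solution with [norm2 eps ^+ 2 / 2] plus the penalty of the target. *)
have := sol D; rewrite /blasso_objective !total_variation_polar// -/r.
rewrite opprD addrA subrr add0r norm2N -!EFinM -!EFinD lee_fin => obj.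
under eq_bigr do rewrite mulrBr mulr1; rewrite sumrB.
have := le_Re_dot_norm2 c r c_le1; have := le_Re_dot_norm2 c eps c_le1.
rewrite -/(E eps) -/(E r) !ler_norml => /andP[e1 _] /andP[r1 _].
(* By [EhD_le], [EhD] and [ED_eq], the left side is at most the difference of the masses minus
   [E r + E eps]; Cauchy-Schwarz bounds the last two terms. *)
apply: (@le_trans _ _ (\sum_(k < n) ha k - \sum_(k < s) a k + norm2 r + norm2 eps)).
  lra.
rewrite -(ler_pM2l lambda_gt0).
(* With [obj], it remains to add two bounds: [lambda * norm2 r - norm2 r ^+ 2 / 2] is at most
   [lambda ^+ 2 / 2] by the square, and [lambda * norm2 eps + norm2 eps ^+ 2 / 2] is at most
   [3 * lambda ^+ 2 / 2]. *)
have := norm2_ge0 eps; have := sqr_ge0 (lambda - norm2 r).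
nra.
Qed.

End blasso_certificate.

Theorem theorem2p1 (R : realType) (X : pointedMetricType R)
  (X_compact : compact [set: X])
  (X_shape : homeomorphic X (set_type (`[0, 1]%classic : set R)) \/
             homeomorphic X (circle R))
  (m : nat) (m_ge1 : (1 <= m)%N)
  (phi : 'I_m.+1 -> X -> R[i])
  (phi_continuous : forall j, continuous (phi j : X -> R[i]^o))
  (phi_orthonormal : exists Pi : probability (borel X) R, orthonormalF phi Pi)
  (s : nat) (a theta : 'I_s.+1 -> R) (T : 'I_s.+1 -> X)
  (a_gt0 : forall k, 0 < a k) (T_inj : injective T)
  (eps y : 'rV[R[i]]_m.+1)
  (y_def : y = moments phi (polar_measure a theta T) + eps)
  (Ca Cb : R) (Ca_gt0 : 0 < Ca) (Cb_gt0 : 0 < Cb) (Cb_lt1 : Cb < 1)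
  (T_QIC : QIC phi T Ca Cb)
  (lambda : R) (lambda_gt0 : 0 < lambda) (lambda_ge : norm2 eps <= lambda)
  (n : nat) (ha htheta : 'I_n -> R) (hT : 'I_n -> X)
  (ha_gt0 : forall k, 0 < ha k) (hT_inj : injective hT)
  (hat_sol : blasso_solution phi y lambda (polar_measure ha htheta hT)) :
  let S := range T in
  let c0 := Num.sqrt (Cb / Ca) in
  let mass x := normc (polar_measure ha htheta hT [set x]) in
  let close x t := S t /\
    mdist x t <= Num.sqrt (2 * lambda / (Ca * mass x)) * (1 / m%:R) <= c0 / m%:R in
  [/\ forall x : X, 2 * lambda / Cb < mass x -> exists t, close x t,
      (forall k l, k != l -> 2 * c0 / m%:R < mdist (T k) (T l)) ->
        forall x : X, 2 * lambda / Cb < mass x -> exists! t, close x t,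
      \sum_(k < n | hT k \in near_set m c0 T)
         ha k * ordmin (fun j => mdist (hT k) (T j) ^+ 2)
        <= 2 * lambda / (Ca * m%:R ^+ 2) &
      \sum_(k < n | hT k \in far_set m c0 T) ha k <= 2 * lambda / Cb].
Proof.
move=> S c0 mass close.
have [Pi Pi_ortho] := phi_orthonormal.
have [P [[c cE] PT QP]] := T_QIC theta.
have M_gt0 : 0 < m%:R :> R by rewrite ltr0n.
pose g x := 1 - normc (P x).
(* The minimum over the support is replaced by an index attaining it, so only one distance has to be
   handled at a time. *)
have gE x : exists j, Num.min (Ca * m%:R ^+ 2 * mdist x (T j) ^+ 2) Cb <= g x.
  have [j jE] := ordmin_attained
    (fun k => Num.min (Ca * m%:R ^+ 2 * mdist x (T k) ^+ 2) Cb).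
  by exists j; rewrite -jE; exact: QP.
have CaM_gt0 : 0 < Ca * m%:R ^+ 2 by rewrite mulr_gt0// exprn_gt0.
(* Nonnegativity of [g] means that [P] has modulus at most 1, as [bessel_le1] requires. *)
have g_ge0 x : 0 <= g x.
  have [j] := gE x; apply: le_trans.
  by rewrite le_min (ltW Cb_gt0) andbT mulr_ge0 ?sqr_ge0// ltW.
have sum_le : \sum_(k < n) ha k * g (hT k) <= 2 * lambda.
  have PE : P = fun x => \sum_(j < m.+1) c j * phi j x by exact/funext.
  have c_le1 : \sum_(j < m.+1) normc (c j) ^+ 2 <= 1.
    apply: (bessel_le1 phi Pi c X_compact phi_continuous Pi_ortho) => x.
    by rewrite -cE -subr_ge0; exact: g_ge0.
  have := blasso_certificate_bound phi phi_continuous a theta T ha htheta hT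
    eps lambda c.
  rewrite -y_def -PE; exact.
have term_ge0 k : 0 <= ha k * g (hT k) by rewrite mulr_ge0// ltW.
have part_le (A : pred 'I_n) : \sum_(k < n | A k) ha k * g (hT k) <= 2 * lambda.
  by apply: le_trans sum_le; rewrite [leRHS](bigID A)//= lerDl sumr_ge0.
have c0_ge0 : 0 <= c0 by exact: sqrtr_ge0.
(* [c0 / m] is the radius at which the quadratic branch of the QIC bound reaches the constant branch
   [Cb]. *)
have c0M : Ca * m%:R ^+ 2 * (c0 / m%:R) ^+ 2 = Cb.
  rewrite expr_div_n sqr_sqrtr ?divr_ge0 ?ltW//.
  by field; rewrite !gt_eqF.
have le_c0 d : 0 <= d -> (d <= c0 / m%:R) = (Ca * m%:R ^+ 2 * d ^+ 2 <= Cb).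
  move=> d0; rewrite -c0M ler_pM2l// ler_pXn2r// nnegrE divr_ge0//.
have closeP x : 2 * lambda / Cb < mass x -> exists t, close x t.
  move=> mass_gt.
  have mass_gt0 : 0 < mass x.
    by apply: le_lt_trans mass_gt; rewrite divr_ge0 ?mulr_ge0// ltW.
  (* A point of positive mass must be one of the atoms of the solution. *)
  have [k kx] : exists k, hT k = x.
    apply: contrapT => /forallNP hTx; move: mass_gt0.
    rewrite /mass /= big1 ?normc0 ?ltxx// => k _.
    by rewrite indicE memNset ?mulr0//; exact: hTx.
  have massE : mass x = ha k.
    rewrite /mass /= (bigD1 k)//= big1 => [|l lk].
      by rewrite addr0 indicE mem_set// mulr1 normc_polar// ltW.
    rewrite indicE memNset ?mulr0//= -kx => /hT_inj/eqP; exact/negP.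
  have hg : ha k * g x <= 2 * lambda.
    apply: le_trans sum_le; rewrite (bigD1 k)//= kx lerDl.
    by rewrite sumr_ge0.
  have [j jg] := gE x.
  (* The mass threshold rules out the constant branch [Cb], leaving the quadratic one. *)
  have g_lt : g x < Cb.
    rewrite -(ltr_pM2l (ha_gt0 k)) (le_lt_trans hg)//.
    by rewrite -ltr_pdivrMr// -massE.
  have dg : Ca * m%:R ^+ 2 * mdist x (T j) ^+ 2 <= g x.
    by move: jg; rewrite ge_min => /orP[//|]; rewrite leNgt g_lt.
  exists (T j); split; first by exists j.
  have q_ge0 : 0 <= 2 * lambda / (Ca * mass x).
    by rewrite divr_ge0 ?mulr_ge0 ?ltW.
  apply/andP; split.
    (* After squaring, the first inequality is [dg] multiplied by [ha k], combined with [hg]. *)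
    rewrite mul1r ler_pdivlMr// -[leLHS]ger0_norm ?mulr_ge0 ?mdist_ge0//.
    rewrite -sqrtr_sqr ler_wsqrtr// ler_pdivlMr ?mulr_gt0//.
    rewrite massE; apply: le_trans hg; rewrite -(ler_pM2l (ha_gt0 k)) in dg.
    by apply: le_trans dg; rewrite le_eqVlt; apply/orP; left; apply/eqP; ring.
  (* Under the square roots, the second inequality is the mass threshold itself. *)
  rewrite mul1r ler_pM2r ?invr_gt0// ler_wsqrtr//.
  rewrite ler_pdivrMr ?mulr_gt0// mulrA divfK ?gt_eqF// -ler_pdivrMl//.
  by rewrite mulrC ltW.
split.
- exact: closeP.
- move=> T_sep x /closeP [t [[j _ <-] xj]]; exists (T j); split.
    by split => //; exists j.
  move=> _ [[l _ <-] xl]; apply: contrapT => Tjl.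
  have jl : j != l by apply/eqP => jl; apply: Tjl; rewrite jl.
  (* Two support points within [c0 / m] of [x] are at most [2 * c0 / m] apart, against the
     separation. *)
  have := T_sep j l jl; apply/negP; rewrite -leNgt.
  move: xj xl => /andP[xj xj'] /andP[xl xl'].
  have := metric_triangle (T j) x (T l); rewrite [mdist (T j) x]metric_sym.
  lra.
- rewrite ler_pdivlMr// mulr_suml; apply: le_trans (part_le _).
  apply: ler_sum => k /set_mem near_k.
  rewrite -mulrA ler_pM2l//.
  (* Two indices are in play: [l] is nearest to [hT k] and handles the branch [Cb], because [hT k]
     is within [c0 / m] of [T l]; [j] comes from QIC and handles the quadratic branch. *)
  have [l lE] := ordmin_attained (fun j => mdist (hT k) (T j)).
  have [j] := gE (hT k); apply: le_trans; rewrite le_min; apply/andP; split.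
    by rewrite mulrC ler_pM2l// ordmin_le.
  apply: (@le_trans _ _ (Ca * m%:R ^+ 2 * mdist (hT k) (T l) ^+ 2)).
    by rewrite mulrC ler_pM2l// ordmin_le.
  by rewrite -le_c0 ?mdist_ge0// -lE.
- rewrite ler_pdivlMr// mulr_suml; apply: le_trans (part_le _).
  apply: ler_sum => k /set_mem far_k.
  rewrite ler_pM2l//.
  (* Far from the support every quadratic branch exceeds [Cb], so the QIC bound becomes
     [Cb <= g (hT k)]. *)
  have [j] := gE (hT k); apply: le_trans; rewrite le_min lexx andbT ltW//.
  rewrite ltNge -le_c0 ?mdist_ge0//; apply/negP => dj.
  by apply: far_k; rewrite /near_set /=; apply: le_trans dj; exact: ordmin_le.
Qed.
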